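(* Let $v>5$ and $k$ be positive integers satisfying $(2v-3)^2-2(2k-1)^2=-1$, and let $e=\binom k2$. Then, with $k_e,j,k',j'$ the unique integers such that $e=\binom{k_e+1}2-j$, $1\le j\le k_e$, and $e=\binom v2-\binom{k'+1}2+j'$, $1\le j'\le k'$, we have $k_e=k$, $j=k$, $k'=k+1$, $j'=2k-v+2$, and there are exactly three optimal partitions in $\mathrm{Dis}(v,e)$, namely $\pi_{1.1}=(v-1,v-2,\dots,k+2,2k-v+2)$, $\pi_{1.2}=(v-2,v-3,\dots,k)$, and $\pi_{2.1}=(k-1,k-2,\dots,2,1)$. The partitions $\pi_{1.3},\pi_{2.2},\pi_{2.3}$ do not exist.
   Context: $\mathcal G(v,e)$ is the set of simple graphs with $v$ vertices and $e$ edges; $P_2(G)$ is the sum of squares of the degrees. $\mathrm{Dis}(v,e)$ is the set of partitions $(a_0,\dots,a_p)$ of $e$ into distinct parts with $v>a_0>\dots>a_p>0$. The threshold graph $\mathrm{Th}(\pi)$ has vertex set $\{0,\dots,v-1\}$ and, for $s=0,\dots,p$, edges $\{s,s+1\},\dots,\{s,s+a_s\}$. A partition $\pi\in\mathrm{Dis}(v,e)$ is optimal if $P_2(\mathrm{Th}(\pi))$ is maximal over $\mathcal G(v,e)$. With $k_e,j,k',j'$ as in the claim: $\pi_{1.1}=(v-1,\dots,k'+1,j')$; $\pi_{1.2}=(v-1,\dots,\widehat{2k'-j'-1},\dots,k'-1)$, defined only if $k'+1\le 2k'-j'-1\le v-1$; $\pi_{1.3}=(v-1,\dots,k'+1,2,1)$,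 defined only if $j'=3$ and $v\ge4$; $\pi_{2.1}=(k_e,\dots,\widehat j,\dots,1)$; $\pi_{2.2}=(2k_e-j-1,k_e-2,\dots,2,1)$, defined only if $k_e+1\le 2k_e-j-1\le v-1$; $\pi_{2.3}=(k_e,k_e-1,\dots,3)$, defined only if $j=3$ and $v\ge4$. (Hats denote omitted entries from a run of consecutive integers.) *)

(* Defs.v *)
From mathcomp Require Import all_boot all_order all_algebra.

Set Implicit Arguments.
Unset Strict Implicit.
Unset Printing Implicit Defensive.

Import GRing.Theory.

(* A simple graph on the vertices 0, ..., v-1 is given by its set of edges,
   each edge being a 2-element set of vertices. *)
Definition simple_graphs (v e : nat) : {set {set {set 'I_v}}} :=
  [set G : {set {set 'I_v}} | [forall E in G, #|E| == 2] & #|G| == e].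

Definition degree (v : nat) (G : {set {set 'I_v}}) (x : 'I_v) : nat :=
  #|[set E in G | x \in E]|.

Definition P2 (v : nat) (G : {set {set 'I_v}}) : nat :=
  \sum_(x < v) degree G x ^ 2.

Definition Dis (v e : nat) : pred (seq nat) :=
  [pred a | [&& sorted gtn a, all [pred i | 0 < i < v] a & sumn a == e]].

(* nth returns 0, contributing no edge, when p.1 is beyond the last part. For a
   in Dis v e, the part a_s satisfies s + a_s < v, so that bounding the vertices
   by v loses no edge. *)
Definition Th (v : nat) (a : seq nat) : {set {set 'I_v}} :=
  [set [set p.1; p.2] | p : 'I_v * 'I_v & p.1 < p.2 <= p.1 + nth 0 a p.1].

Definition optimal (v e : nat) (a : seq nat) : Prop :=
  a \in Dis v e /\
  forall G, G \in simple_graphs v e -> P2 G <= P2 (Th v a).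

(* The differences are taken in int, so that they are not truncated. *)
Definition complete_rep (e ke j : nat) : Prop :=
  (e%:Z = 'C(ke.+1, 2)%:Z - j%:Z)%R /\ 1 <= j <= ke.

Definition star_rep (v e k' j' : nat) : Prop :=
  (e%:Z = 'C(v, 2)%:Z - 'C(k'.+1, 2)%:Z + j'%:Z)%R /\ 1 <= j' <= k'.

(* n, n-1, ..., m; empty when n < m. *)
Definition run (n m : nat) : seq nat := rev (iota m (n + 1 - m)).

(* None means that the partition does not exist. For 1 <= v, 1 <= j' <= k' and
   1 <= j <= ke, no subtraction written below is truncated, neither in the
   conditions nor in a partition that exists. *)
Definition pi11 (v k' j' : nat) : seq nat := rcons (run (v - 1) (k' + 1)) j'.

Definition pi12 (v k' j' : nat) : option (seq nat) :=
  if k' + 1 <= 2 * k' - j' - 1 <= v - 1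
  then Some (rem (2 * k' - j' - 1) (run (v - 1) (k' - 1))) else None.

Definition pi13 (v k' j' : nat) : option (seq nat) :=
  if (j' == 3) && (4 <= v) then Some (run (v - 1) (k' + 1) ++ [:: 2; 1])
  else None.

Definition pi21 (ke j : nat) : seq nat := rem j (run ke 1).

Definition pi22 (v ke j : nat) : option (seq nat) :=
  if ke + 1 <= 2 * ke - j - 1 <= v - 1
  then Some ((2 * ke - j - 1) :: run (ke - 2) 1) else None.

Definition pi23 (v ke j : nat) : option (seq nat) :=
  if (j == 3) && (4 <= v) then Some (run ke 3) else None.

(* Main.v *)
Require Import Defs.
From mathcomp Require Import all_boot all_order all_algebra.
From mathcomp Require Import zify.

(* A graph with given numbers of vertices and edges that maximizes P2 has nested
   neighbourhoods, hence a dominating or an isolated vertex. Deleting such vertices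
   one by one shows that threshold graphs suffice, and that they are described by one
   bit per deleted vertex. Let C(x) be P2 of the quasi-complete graph with x edges,
   and S(n, x) that of the quasi-star on n vertices, the complement of a
   quasi-complete graph. By induction over the bits, P2 <= max(C, S). The Pell
   equation says that e is half of 'C(v - 1, 2), so that the clique K_k and its
   complement in v - 1 vertices have the same P2, and S(v, e) = S(v - 1, e) = C(e).
   Every other choice of the first bits loses strictly against C(e); complementing
   exchanges the roles of dominating and isolated vertices, so only the cases with
   an isolated vertex need an argument. *)

Set Implicit Arguments.
Unset Strict Implicit.
Unset Printing Implicit Defensive.

(** * P2 of quasi-complete graphs *)

(* The quasi-complete graph inserts the edges {r, q}, r < q, in colexicographic
   order; cell x is the pair (q, r) for the x-th of them. *)
Fixpoint cell (x : nat) : nat * nat :=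
  if x is x'.+1 then
    let: (q, r) := cell x' in if r.+1 < q then (q, r.+1) else (q.+1, 0)
  else (1, 0).

(* In a threshold graph on vertices numbered by decreasing degree, P2 is the sum
   of 2 (x + y) over the edges {x, y}; hence qc x is P2 of the quasi-complete
   graph with x edges. *)
Fixpoint qc (x : nat) : nat :=
  if x is x'.+1 then qc x' + 2 * ((cell x').1 + (cell x').2) else 0.

Lemma bin2D n : 2 * 'C(n, 2) = n * n.-1.
Proof. by have := bin_ffact n 2; rewrite ffactnS ffactn1 mulnC. Qed.

Lemma cellP x : (cell x).2 < (cell x).1 /\ 'C((cell x).1, 2) + (cell x).2 = x.
Proof.
elim: x => [//|x] /=; case: (cell x) => q r /= [rq <-].
case: ifP => h /=; rewrite ?addnS //; split=> //.
by rewrite binS bin1 addn0; lia.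
Qed.

Lemma bin2_lt q q' : q < q' -> 'C(q, 2) + q <= 'C(q', 2).
Proof. by move=> h; have := bin2D q; have := bin2D q'; nia. Qed.

Lemma cell_eq q r : r < q -> cell ('C(q, 2) + r) = (q, r).
Proof.
move=> rq; have := cellP ('C(q, 2) + r).
case: (cell _) => q' r' /= [r'q' E].
have [/bin2_lt|/bin2_lt|] := ltngtP q q'; [lia | lia | move=> h].
by move: E; rewrite h => E; congr pair; lia.
Qed.

(** The graph is K_q with one more vertex joined to r of its vertices, so P2 is r q^2 + (q - r) (q -
    1)^2 + r^2. *)
Lemma qcE q r : r <= q ->
  qc ('C(q, 2) + r) + 2 * q * q + r = q * q * q + q + 2 * q * r + r * r.
Proof.
elim: q r => [|q IH] r; first by case: r.
elim: r => [_|r IHr rq].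
  rewrite binS bin1 !addn0; have := IH q (leqnn _); nia.
have := IHr (ltnW rq); rewrite ['C(_, 2) + r.+1]addnS [qc _.+1]/= cell_eq //=; nia.
Qed.

(* With x = 'C(q, 2) + r and d = q + u, the excess qc (x + d) - qc x - 4 x - d (d + 1)
   is 2 r (u - 1) while the d new edges reach row q + 1, and 2 (q - r) (q + 1 - u)
   when they reach row q + 2; both are written without subtraction. *)
Lemma qc_row q r u : r <= q -> r + u <= q.+1 ->
  qc ('C(q, 2) + r + (q + u)) + 2 * r = qc ('C(q, 2) + r) + 4 * ('C(q, 2) + r)
    + (q + u) * (q + u).+1 + 2 * r * u.
Proof.
move=> rq h.
have -> : 'C(q, 2) + r + (q + u) = 'C(q.+1, 2) + (r + u) by rewrite binS bin1; lia.
have := bin2D q; have := qcE rq; have := @qcE q.+1 (r + u) h.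
by case: q {h rq} => [|q] /=; nia.
Qed.

Lemma qc_row2 q r u : q < r + u -> r + u <= 2 * q + 3 -> r <= q ->
  qc ('C(q, 2) + r + (q + u)) + 2 * q * u + 2 * r * q + 2 * r =
    qc ('C(q, 2) + r) + 4 * ('C(q, 2) + r)
    + (q + u) * (q + u).+1 + 2 * r * u + 2 * q * q + 2 * q.
Proof.
move=> h1 h2 rq.
have [w ew] : exists w, r + u = q.+1 + w by exists (r + u - q.+1); lia.
have -> : 'C(q, 2) + r + (q + u) = 'C(q.+2, 2) + w by rewrite !binS !bin1 bin0; lia.
have := bin2D q.
have := qcE rq; have wq : w <= q.+2 by lia.
have := qcE wq.
have -> : u = q.+1 + w - r by lia.
have : r <= q.+1 + w by lia.
by case: q {h1 h2 rq wq ew} => [|q] /=; nia.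
Qed.

(** On the left, a dominating vertex of degree d joins the quasi-complete graph with x edges. Both
    excesses above are nonnegative, except at u = 0, where [x <= 'C(d, 2)] forces r = 0. *)
Lemma qc_star_le x d : x <= 'C(d, 2) -> d <= 2 * (cell x).1 + 1 ->
  qc x + 4 * x + d * d.+1 <= qc (x + d).
Proof.
have [] := cellP x; case: (cell x) => q r /= rq ex xd dq.
have [dltq|qled] := ltnP d q.
  have := bin2_lt dltq => h; have d0 : d = 0 by lia.
  by move: xd; rewrite d0; case: (x).
have [u eu] : exists u, d = q + u by exists (d - q); lia.
subst d; have [h|h] := leqP (r + u) q.+1.
  have := qc_row (ltnW rq) h; rewrite ex.
  case: u {h dq qled} xd => [|u] xd; last by nia.
  by have -> : r = 0 by [move: xd; rewrite addn0; lia]; lia.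
have h' : r + u <= 2 * q + 3 by lia.
have := qc_row2 (ltnW h) h' (ltnW rq); rewrite ex.
have [s es] : exists s, q = r + s by exists (q - r); lia.
have [t et] : exists t, q.+1 = u + t by exists (q.+1 - u); lia.
have : s * q.+1 = s * (u + t) by rewrite et.
by subst q; nia.
Qed.

Definition cell_sum x := (cell x).1 + (cell x).2.

Lemma cell_sumS x : cell_sum x.+1 <= (cell_sum x).+1.
Proof. by rewrite /cell_sum /=; case: (cell x) => q r; case: ifP => /=; lia. Qed.

Lemma qcS x : qc x.+1 = qc x + 2 * cell_sum x. Proof. by []. Qed.

(** One more edge adds 2 [cell_sum] to [qc] and 2 (d + 1) to [d * d.+1]; as [cell_sum] grows by at
    most 1 per edge, the second stays ahead. *)
Lemma qc_star_mono x d d' : d <= d' -> cell_sum (x + d) <= d.+1 ->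
  qc (x + d') + d * d.+1 <= qc (x + d) + d' * d'.+1.
Proof.
move=> /subnK <- h; elim: (d' - d) => [//|i IH].
have {}h : cell_sum (x + (i + d)) <= (i + d).+1.
  elim: i {IH} => [//|i IH]; have := cell_sumS (x + (i + d)).
  by rewrite addSn addnS; lia.
by rewrite addSn addnS qcS; nia.
Qed.

(** At d = 2 q + 1, that is u = q + 1, the excess vanishes; [qc_star_mono] takes over from there. *)
Lemma qc_star_ge x d : 2 * (cell x).1 + 1 <= d ->
  qc (x + d) <= qc x + 4 * x + d * d.+1.
Proof.
have [] := cellP x; case: (cell x) => q r /= rq ex qd.
have e : x + (2 * q + 1) = 'C(q.+2, 2) + r by rewrite -ex !binS !bin1 bin0; lia.
have := @qc_star_mono x _ _ qd; rewrite e {1}/cell_sum cell_eq /=; last by lia.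
move=> /(_ ltac:(lia)).
suff : qc ('C(q.+2, 2) + r) <= qc x + 4 * x + (2 * q + 1) * (2 * q + 1).+1 by lia.
have := qcE (ltnW rq); rewrite ex; have h : r <= q.+2 by lia.
have := qcE h; have := bin2D q; case: q {qd e h} rq ex => [|q] rq ex; first by [].
by rewrite succnK; lia.
Qed.

Lemma qc_le_star x : qc x <= x * x.+1.
Proof. by have := @qc_star_mono 0 0 x isT isT; rewrite !add0n; lia. Qed.

(** The triangle ties with the star on 3 edges; with 4 edges the values are 18 and 20. *)
Lemma qc_lt_star x : 3 < x -> qc x < x * x.+1.
Proof. by move=> h; have := @qc_star_mono 0 4 x h isT; rewrite (_ : qc (0 + 4) = 18) // !add0n; lia. Qed.

(** By complementation, the quasi-star with y edges on d + 1 vertices does not beat the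
    quasi-complete graph. The induction takes a dominating vertex off the x non-edges, by
    [qc_star_ge], until a star bounds them. *)
Lemma qc_skew d x y : x + y = 'C(d.+1, 2) -> 2 * (cell x).1 + 1 <= d ->
  qc x + 2 * d * y + (3 < x) <= qc y + 2 * d * x.
Proof.
elim: d x y => [|d IH] x y exy; first by lia.
have [xd|dx] := leqP x d.+1.
  move=> _; have ey : y = 'C(d.+1, 2) + (d.+1 - x) by move: exy; rewrite binS bin1; lia.
  have : qc x + (3 < x) <= x * x.+1.
    by case: ltnP => h; [have := qc_lt_star h | have := qc_le_star x]; lia.
  have := @qcE d.+1 (d.+1 - x) (leq_subr _ _); rewrite -ey.
  have := bin2D d.+1 => /=; nia.
have [z ez] : exists z, x = z + d.+1 by exists (x - d.+1); lia.
subst x => hq; have ezy : z + y = 'C(d.+1, 2) by move: exy; rewrite binS bin1; lia.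
have [] := cellP z; have [] := cellP (z + d.+1).
move: hq; case: (cell (z + d.+1)) => q r /= hq rq ex.
case ec: (cell z) => [q' r'] /= r'q' ez.
have hq' : q' + 2 <= q.
  have q'q : q' <= q by rewrite leqNgt; apply/negP => /bin2_lt; lia.
  rewrite leqNgt; apply/negP => h; have [eq|eq] : q = q' \/ q = q'.+1 by lia.
    by subst q'; lia.
  by move: ex; rewrite eq binS bin1; lia.
have := IH z y ezy; rewrite ec /= => /(_ ltac:(lia)).
have D := @qc_star_ge z d.+1; rewrite ec /= in D; have {}D := D ltac:(lia).
have := bin2D d.+1 => /=.
have [z3|z3] := ltnP 3 z.
  by nia.
(* More than 2 q + 1 edges ending in row q force q >= 5. For z <= 3 the induction hypothesis is not
   strict, so strictness has to come from this step. *)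
have d11 : 11 <= d.+1 by have := bin2D q; nia.
have {}D : qc (z + d.+1) < qc z + 4 * z + d.+1 * d.+2.
  have := @qc_star_mono z 11 d.+1 d11.
  by case: z z3 {ez exy ezy ec D ex dx} => [|[|[|[|]]]] //= _ /(_ isT); lia.
by nia.
Qed.

Arguments qc : simpl never.

(** * Threshold graphs as bit sequences *)

(* P2 (Th a): a dominating vertex of degree x adds 1 to x degrees whose sum was
   twice the number of the remaining edges. *)
Fixpoint sqd (a : seq nat) : nat :=
  if a is x :: a' then sqd a' + 4 * sumn a' + x * x.+1 else 0.

(* A partition into distinct parts at most n is given by n bits, the one for the part
   n first. Negating the bits complements the threshold graph on n + 1 vertices. *)
Fixpoint parts (b : seq bool) : seq nat :=
  if b is x :: b' then
    if x then (size b').+1 :: parts b' else parts b'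
  else [::].

Lemma sumn_parts_negb b :
  sumn (parts b) + sumn (parts (map negb b)) = 'C((size b).+1, 2).
Proof.
elim: b => [//|x b IH] /=; rewrite binS bin1 -IH size_map.
by case: x => /=; lia.
Qed.

(** With n = [size b], complementation turns a degree d into n - d, and the degrees sum to twice the
    number of edges. *)
Lemma sqd_parts_negb b :
  sqd (parts b) + 2 * size b * sumn (parts (map negb b)) =
  sqd (parts (map negb b)) + 2 * size b * sumn (parts b).
Proof.
elim: b => [//|x b IH]; have := sumn_parts_negb b; have := bin2D (size b).+1.
by rewrite /=; case: x => /=; rewrite ?size_map; nia.
Qed.

(* Let x be the number of non-edges and y the number of edges on d vertices. Either
   the quasi-star does not lose when it may use one more vertex, or the
   quasi-complete graph is as good as the quasi-star on d vertices, and better if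
   x > 3. *)
Lemma qc_trade d x y : x + y = 'C(d, 2) ->
  qc x + 4 * x + d * d.+1 <= qc (x + d) \/
  qc x + 2 * d.-1 * y + (3 < x) <= qc y + 2 * d.-1 * x.
Proof.
move=> exy; have [h|h] := leqP d (2 * (cell x).1 + 1).
  by left; apply: qc_star_le => //; rewrite -exy leq_addr.
by right; case: d exy h => [|d] exy h; [lia | apply: qc_skew => //; lia].
Qed.

(* The theorem of Ahlswede and Katona for threshold graphs: the quasi-complete graph
   or the quasi-star is best. *)
Lemma sqd_parts_le b (e := sumn (parts b)) (y := sumn (parts (map negb b))) :
  sqd (parts b) <= qc e \/
  sqd (parts b) + 2 * size b * y <= qc y + 2 * size b * e.
Proof.
rewrite {}/e {}/y; elim: b => [|x b IH]; first by left.
have E := sumn_parts_negb b; have := bin2D (size b).+1; rewrite -E succnK /=.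
move=> B; case: x => /=; rewrite ?size_map.
  (* A dominating vertex turns a quasi-star into a quasi-star. The trade says that the
     quasi-complete graph can absorb the new edges, or that the quasi-star was already at least as
     good. *)
  have [h|h] := qc_trade E; rewrite ?succnK in h.
    by case: IH => IH; [left; rewrite [_.+1 + sumn _]addnC; lia | right; nia].
  by right; case: IH => IH; nia.
move: E; rewrite addnC => E; have [h|h] := qc_trade E; rewrite ?succnK in h.
  case: IH => IH; [by left | right].
  by rewrite [_.+1 + sumn _]addnC; nia.
by left; case: IH => IH; nia.
Qed.

(* Both inequalities say that, on n (resp. N) vertices, the quasi-star with e
   edges has a smaller P2 than the quasi-complete graph: by complementation its P2
   is qc y + 2 (n - 1) (e - y), where y is the number of non-edges. *)
Lemma star_lt e n N : n <= N -> e + 4 <= 'C(n, 2) ->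
  qc ('C(N, 2) - e) + 2 * N.-1 * e < qc e + 2 * N.-1 * ('C(N, 2) - e) ->
  qc ('C(n, 2) - e) + 2 * n.-1 * e < qc e + 2 * n.-1 * ('C(n, 2) - e).
Proof.
move=> nN; rewrite -(subKn nN); elim: (N - n) => [|i IH]; first by rewrite subn0.
rewrite subnS; case: (N - i) IH => [//|m] IH; rewrite succnK => h.
have h' : e + 4 <= 'C(m.+1, 2) by rewrite binS bin1; lia.
move=> /(IH h') {}IH; have E : 'C(m, 2) - e + e = 'C(m, 2) by lia.
(* Either the quasi-star on m vertices is no better than on m + 1, or the strict part of the trade
   applies, there being at least 4 non-edges. *)
have [D|] := qc_trade E; last by rewrite (_ : (3 < _) = true); lia.
move: IH; rewrite binS bin1; have -> : 'C(m, 2) + m - e = 'C(m, 2) - e + m by lia.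
have := bin2D m; rewrite -E; case: m h E D {h'} => [|m] h E D; first by lia.
move: D; rewrite !succnK; move: ('C(m.+1, 2) - e) => z; rewrite addnK; lia.
Qed.

Lemma parts_ncons0 i b : parts (nseq i false ++ b) = parts b.
Proof. by elim: i. Qed.

(* Peeling off the largest part d of b leaves either a quasi-complete graph, excluded
   by the first strict hypothesis, or a quasi-star, excluded by the second. *)
Lemma qc_unique b e n0 :
    sumn (parts b) = e -> sqd (parts b) = qc e -> n0.+1 <= size b ->
    (forall d, n0 < d <= size b -> qc (e - d) + 4 * (e - d) + d * d.+1 < qc e) ->
    (forall n, n0.+1 < n <= (size b).+1 ->
       qc ('C(n, 2) - e) + 2 * n.-1 * e < qc e + 2 * n.-1 * ('C(n, 2) - e)) ->
  exists2 b', b = nseq (size b - n0) false ++ b' & size b' = n0.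
Proof.
elim: b => [//|x b IH] /= we Fe nb Dlt Slt.
case: x we Fe => /= we Fe; last first.
  have [nb'|nb'] := leqP n0.+1 (size b).
    case: (IH we Fe nb') => [d h|n h|b' eb sb'].
    - by apply: Dlt; lia.
    - by apply: Slt; lia.
    by exists b' => //; rewrite subSn ?(ltnW nb') //= -eb.
  have sb : size b = n0 by lia.
  by exists b; rewrite ?sb // subSn // subnn.
exfalso; have D := Dlt (size b).+1; have S := Slt (size b).+2.
have {}D := D ltac:(lia); have {}S := S ltac:(lia).
have E : e - (size b).+1 = sumn (parts b) by lia.
have Ec := sumn_parts_negb b; have B := bin2D (size b).+1.
have E2 : 'C((size b).+2, 2) - e = sumn (parts (map negb b)).
  by rewrite binS bin1; lia.
rewrite E in D; rewrite E2 in S; rewrite !succnK -Ec in S B.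
case: (sqd_parts_le b) => h; first by lia.
move: B S D h Fe we; clear; move: (sumn _) (sumn _) (sqd _) => s t f.
by move=> B S D h F E; rewrite -E in S D F; lia.
Qed.

(** * Reduction to threshold graphs *)

Section Graphs.
Variable v : nat.
Implicit Types (G : {set {set 'I_v}}) (W E : {set 'I_v}) (x y z w : 'I_v).

(** Deleting a vertex shrinks [W] but keeps the type ['I_v], so [degree] and [P2] apply
    unchanged. *)
Definition graph_on W G := [forall E in G, (E \subset W) && (#|E| == 2)].

Lemma degreeE G x : degree G x = \sum_(E in G) (x \in E).
Proof.
rewrite /degree -sum1_card big_mkcond [RHS]big_mkcond /=.
by apply: eq_bigr => E _; rewrite inE; case: (E \in G); case: (x \in E).
Qed.

Lemma degree_set0 x : degree set0 x = 0.
Proof. by rewrite degreeE big_set0. Qed.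

Lemma degree_move G E E' x : E \in G -> E' \notin G ->
  degree (E' |: G :\ E) x + (x \in E) = degree G x + (x \in E').
Proof.
move=> EG E'G; rewrite !degreeE big_setU1 /=; last by rewrite !inE (negbTE E'G) andbF.
by rewrite (big_setD1 E EG) /= -addnA [RHS]addnC; congr (_ + _); rewrite addnC.
Qed.

Lemma card_move (T : finType) (A : {set T}) a b : a \in A -> b \notin A ->
  #|b |: A :\ a| = #|A|.
Proof.
by move=> aA bA; rewrite cardsU1 !inE (negbTE bA) andbF [RHS](cardsD1 a) aA.
Qed.

Lemma edge_pair G W E x : graph_on W G -> E \in G -> x \in E ->
  exists2 y, y != x & E = [set x; y].
Proof.
move=> /forall_inP/(_ E) h /h /andP[_ /cards2P[a [b [ab ->]]]].
rewrite !inE => /orP[] /eqP->; first by exists b; rewrite // eq_sym.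
by exists a; rewrite // setUC.
Qed.

(** Degrees a >= b + 1 become a + 1 and b, which gains 2 (a - b) > 0. *)
Lemma P2_move G W x y z : graph_on W G ->
  degree G y <= degree G x -> [set y; z] \in G -> z != x -> y != x -> y != z ->
  [set x; z] \notin G ->
  P2 G < P2 ([set x; z] |: G :\ [set y; z]).
Proof.
move=> GW yx yzG zx yx' yz xzG; rewrite /P2.
set H := _ |: _.
have dH u : degree H u + (u == y) = degree G u + (u == x).
  have := degree_move u yzG xzG; rewrite -/H !inE.
  case: (eqVneq u z) => [->|_]; last by rewrite !orbF.
  by rewrite !orbT (negbTE zx) eq_sym (negbTE yz); lia.
rewrite (bigD1 x) //= (bigD1 y) //= [X in _ < X](bigD1 x) //= [X in _ < _ + X](bigD1 y) //=.
have -> : \sum_(i < v | (i != x) && (i != y)) degree H i ^ 2 =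
          \sum_(i < v | (i != x) && (i != y)) degree G i ^ 2.
  apply: eq_bigr => i /andP[ix iy]; have := dH i.
  by rewrite (negbTE ix) (negbTE iy) !addn0 => ->.
have := dH x; have := dH y; rewrite !eqxx [x == y]eq_sym (negbTE yx').
move: yx; rewrite /= !addn0 !addn1 => yx eb ea; rewrite ea; move: yx; rewrite -eb.
by move: (degree G x) (degree H y) => a b ab; rewrite !addnA ltn_add2r; nia.
Qed.

Lemma graph_move W G x y z : graph_on W G -> [set y; z] \in G -> x \in W -> z != x ->
  graph_on W ([set x; z] |: G :\ [set y; z]).
Proof.
move=> /forall_inP GW yzG xW zx; apply/forall_inP => E; rewrite !inE.
case/orP=> [/eqP->|/andP[_ /GW]//]; rewrite cards2 [x == z]eq_sym zx andbT subUset !sub1set xW.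
by case/andP: (GW _ yzG) => /subsetP/(_ z); rewrite !inE eqxx orbT => ->.
Qed.

Lemma max_nested W G : graph_on W G ->
  (forall H, graph_on W H -> #|H| = #|G| -> P2 H <= P2 G) ->
  forall x y z, x \in W -> degree G y <= degree G x -> [set y; z] \in G -> z != x ->
    [set x; z] \in G.
Proof.
move=> GW Gmax x y z xW yx yzG zx; case: (eqVneq y x) => [<-//|yx'].
have yz : y != z.
  apply: contraL yzG => /eqP->; apply/negP => /(forall_inP GW) /andP[_].
  by rewrite setUid cards1.
apply: contraT => xzG; have := Gmax _ (graph_move GW yzG xW zx) (card_move yzG xzG).
by rewrite leqNgt (P2_move GW).
Qed.

Lemma degree0P G x : degree G x = 0 -> forall E, E \in G -> x \notin E.
Proof.
move=> /eqP; rewrite cards_eq0 => /eqP h E EG; apply/negP => xE.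
by have := in_set0 E; rewrite -h inE EG xE.
Qed.

Lemma degree_out W G x : graph_on W G -> x \notin W -> degree G x = 0.
Proof.
move=> /forall_inP GW xW; apply/eqP; rewrite cards_eq0; apply/eqP/setP => E.
rewrite !inE; apply/negP => /andP[/GW /andP[/subsetP/(_ x)]].
by rewrite (negbTE xW) => h _ /h.
Qed.

(** A neighbour of z has degree at most that of x, so by nestedness x is adjacent to every
    non-isolated z. *)
Lemma max_degree_ends W G x : graph_on W G -> x \in W ->
  (forall H, graph_on W H -> #|H| = #|G| -> P2 H <= P2 G) ->
  (forall y, y \in W -> degree G y <= degree G x) ->
  (forall z, z \in W -> z != x -> [set x; z] \in G) \/
  exists2 z, z \in W & degree G z = 0.
Proof.
move=> GW xW Gmax xmax.
have [/forall_inP h|] := boolP [forall z in W, (z != x) ==> ([set x; z] \in G)].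
  by left=> z zW; apply/implyP/h.
rewrite negb_forall_in => /exists_inP[z zW]; rewrite negb_imply => /andP[zx xzG].
right; exists z => //; apply/eqP; rewrite cards_eq0; apply/set0Pn => -[E].
rewrite inE => /andP[EG zE]; have [y yz eE] := edge_pair GW EG zE.
have yW : y \in W.
  by case/andP: (forall_inP GW _ EG) => /subsetP h _; apply: h; rewrite eE !inE eqxx orbT.
by case/negP: xzG; apply: (max_nested GW Gmax xW (xmax y yW)) => //; rewrite setUC -eE.
Qed.

(** The other degrees in W rise by 1, and they summed to 2 [#|H|]. *)
Lemma dominating_P2 W G x : graph_on W G -> x \in W ->
  (forall z, z \in W -> z != x -> [set x; z] \in G) ->
  exists2 H, graph_on (W :\ x) H &
    #|G| = #|H| + #|W|.-1 /\ P2 G = P2 H + 4 * #|H| + #|W|.-1 * #|W|.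
Proof.
move=> GW xW dom; pose H := [set E in G | x \notin E].
have HW : graph_on (W :\ x) H.
  apply/forall_inP => E; rewrite inE => /andP[/(forall_inP GW) /andP[EW ->] xE].
  by rewrite subsetD1 EW xE.
exists H => //.
have dx : [set E in G | x \in E] = [set [set x; z] | z in W :\ x].
  apply/setP => E; rewrite inE; apply/andP/imsetP => [[EG xE]|[z]].
    have [z zx eE] := edge_pair GW EG xE; exists z => //.
    rewrite !inE zx; case/andP: (forall_inP GW _ EG) => /subsetP h _; apply: h.
    by rewrite eE !inE eqxx orbT.
  by rewrite !inE => /andP[zx zW] ->; rewrite dom // !inE eqxx.
have inj : {in W :\ x &, injective (fun z => [set x; z])}.
  move=> y z; rewrite !inE => /andP[yx _] /andP[zx _] /setP/(_ y).
  by rewrite !inE eqxx (negbTE yx) /= => /esym /eqP.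
have degx : degree G x = #|W|.-1.
  by rewrite /degree dx card_in_imset // (cardsD1 x W) xW.
have cG : #|G| = #|H| + #|W|.-1.
  rewrite -degx /degree -(cardsID [set E : {set 'I_v} | x \in E] G) addnC.
  by congr (_ + _); apply: eq_card => E; rewrite !inE // andbC.
split=> //.
have degH y : y != x -> degree G y = degree H y + (y \in W).
  move=> yx; rewrite /degree -(cardsID [set E : {set 'I_v} | x \in E]) addnC.
  congr (_ + _); first by apply: eq_card => E; rewrite !inE; case: (x \in E); rewrite ?andbT ?andbF.
  case: (boolP (y \in W)) => yW.
    apply/eqP/cards1P; exists [set x; y]; apply/setP => E; rewrite !inE.
    apply/idP/eqP => [/andP[/andP[EG yE] xE]|->].
      have [z zx eE] := edge_pair GW EG xE; move: yE; rewrite eE !inE (negbTE yx).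
      by move=> /eqP->.
    by rewrite dom // !inE !eqxx orbT.
  apply/eqP; rewrite cards_eq0 -subset0; apply/subsetP => E; rewrite !inE.
  case/andP=> /andP[EG yE] _; have := degree_out GW yW => /degree0P/(_ E EG).
  by rewrite yE.
have degHx : degree H x = 0 by apply: (degree_out HW); rewrite !inE eqxx.
have sumH : \sum_(y | y != x) degree H y = 2 * #|H|.
  transitivity (\sum_y degree H y); first by rewrite [RHS](bigD1 x) //= degHx.
  under eq_bigr do rewrite degreeE; rewrite exchange_big /=.
  rewrite mulnC -sum_nat_const; apply: eq_bigr => E EH.
  rewrite -big_mkcond /= sum1_card; apply/eqP.
  by case/andP: (forall_inP HW _ EH).
rewrite /P2 (bigD1 x) //= [in RHS](bigD1 x) //= degx degHx.
transitivity (#|W|.-1 ^ 2 + \sum_(y | y != x) (degree H y ^ 2 + 2 * degree H y + (y \in W))).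
  congr (_ + _); apply: eq_bigr => y yx; rewrite degH //.
  case: (boolP (y \in W)) => yW; first by nia.
  rewrite (degree_out HW) //; by rewrite !inE negb_and yW orbT.
rewrite big_split big_split -big_distrr /= sumH.
have -> : \sum_(y | y != x) (y \in W) = #|W|.-1.
  rewrite (cardsD1 x) xW /= -sum1_card [RHS]big_mkcond [LHS]big_mkcond /=.
  by apply: eq_bigr => y _; rewrite !inE; case: (y != x).
have : 0 < #|W| by apply/card_gt0P; exists x.
case: #|W| => // n _; rewrite !succnK exp0n // -!mulnn.
by move: (\sum_(i | _) _) #|H| => S h; lia.
Qed.

Lemma P2_le_sqd W G n : graph_on W G -> #|W| = n.+1 ->
  exists2 b, size b = n & sumn (parts b) = #|G| /\ P2 G <= sqd (parts b).
Proof.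
elim: n W G => [|n IH] W G GW cW.
  exists [::] => //=; have -> : G = set0.
    apply/setP => E; rewrite inE; apply/negP => /(forall_inP GW) /andP[/subset_leq_card].
    by rewrite cW => h /eqP h2; rewrite h2 in h.
  by rewrite cards0; split=> //; rewrite /P2 big1 // => x _; rewrite degree_set0.
(* Nestedness holds for maximizers only, so each round first replaces [G] by one. *)
pose Q := [pred H | graph_on W H && (#|H| == #|G|)].
have QG : Q G by rewrite /= GW eqxx.
case: (arg_maxnP (@P2 v) QG) => H /andP[HW /eqP cH] Hmax.
have {}Hmax K : graph_on W K -> #|K| = #|H| -> P2 K <= P2 H.
  by move=> KW cK; apply: Hmax; rewrite /= KW cK cH eqxx.
have [x0 x0W] : exists x, x \in W by apply/card_gt0P; rewrite cW.
case: (arg_maxnP (degree H) x0W) => x xW0 xmax; have {xW0} xW : x \in W by [].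
have PGH := Hmax _ GW (esym cH).
have [dom|[z zW z0]] := max_degree_ends HW xW Hmax xmax.
  have [K KW [eK PK]] := dominating_P2 HW xW dom.
  have [|b sb [wb Fb]] := IH _ _ KW; first by move: cW; rewrite (cardsD1 x W) xW => -[].
  exists (true :: b); rewrite /= ?sb // wb -cH eK PK cW /= in PGH *.
  by split; lia.
have [||b sb [wb Fb]] := IH (W :\ z) H; last first.
- by exists (false :: b); rewrite /= ?sb // wb cH; split=> //; apply: leq_trans Fb.
- by move: cW; rewrite (cardsD1 z W) zW => -[].
apply/forall_inP => E EH; case/andP: (forall_inP HW _ EH) => EW ->.
by rewrite subsetD1 EW (degree0P z0).
Qed.

End Graphs.

(** * ** Edges and degrees of [Th] *)

Definition adj (a : seq nat) (x y : nat) : bool := x < y <= x + nth 0 a x.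

Definition adj_degree (a : seq nat) (v x : nat) : nat :=
  \sum_(y < v) (adj a x y + adj a y x).

Lemma set2_inj_lt v (p q : 'I_v * 'I_v) : p.1 < p.2 -> q.1 < q.2 ->
  [set p.1; p.2] = [set q.1; q.2] -> p = q.
Proof.
case: p q => [a b] [c d] /= ab cd /setP E.
have := E a; have := E b; have := E c; rewrite !inE !eqxx ?orbT /= -!val_eqE /=.
by move=> h1 h2 h3; congr pair; apply: val_inj => /=; lia.
Qed.

Lemma sum_Th v a (F : {set 'I_v} -> nat) :
  \sum_(E in Th v a) F E = \sum_(x < v) \sum_(y < v) adj a x y * F [set x; y].
Proof.
rewrite big_imset /=; last first.
  by move=> p q; rewrite !inE => /andP[pl _] /andP[ql _]; apply: set2_inj_lt.
rewrite pair_bigA big_mkcond /=; apply: eq_bigr => p _.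
by rewrite inE -/(adj a p.1 p.2); case: (adj _ _ _); rewrite ?mul1n.
Qed.

Lemma card_Th v a : #|Th v a| = \sum_(x < v) \sum_(y < v) adj a x y.
Proof.
rewrite -sum1_card (sum_Th a (fun _ => 1)).
by apply: eq_bigr => x _; apply: eq_bigr => y _; rewrite muln1.
Qed.

Lemma degree_Th v a (x : 'I_v) : degree (Th v a) x = adj_degree a v x.
Proof.
rewrite degreeE (sum_Th a (fun E => nat_of_bool (x \in E))) /adj_degree big_split /=.
transitivity (\sum_(i < v) (\sum_(j < v) adj a i j * (i == x) + \sum_(j < v) adj a i j * (j == x))).
  apply: eq_bigr => i _; rewrite -big_split /=; apply: eq_bigr => j _.
  rewrite !inE ![x == _]eq_sym -mulnDr.
  case: eqVneq => [->|_]; case: eqVneq => [->|_] //=.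
  by rewrite /adj ltnn.
rewrite big_split /=; congr (_ + _).
  rewrite (bigD1 x) //= [X in _ + X]big1 ?addn0 => [|i ix].
    by apply: eq_bigr => j _; rewrite eqxx muln1.
  by rewrite big1 // => j _; rewrite (negbTE ix) muln0.
apply: eq_bigr => i _; rewrite (bigD1 x) //= eqxx muln1 big1 ?addn0 // => j jx.
by rewrite (negbTE jx) muln0.
Qed.

Lemma adj_cons a0 a x y : adj (a0 :: a) x.+1 y.+1 = adj a x y.
Proof. by rewrite /adj /= ltnS addSn ltnS. Qed.

Lemma sum_ltn n m : m <= n -> \sum_(y < n) (y < m) = m.
Proof.
move=> mn; rewrite -big_mkcond /= -(big_mkord (fun y => y < m) (fun _ => 1)).
by rewrite -(big_nat_widen 0 m n xpredT) // sum_nat_const_nat subn0 muln1.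
Qed.

Lemma path_gtn_nth a0 a x : path gtn a0 a -> 0 < nth 0 a x -> x + nth 0 a x < a0.
Proof.
elim: a a0 x => [|a1 a IH] a0 [|x] //= /andP[a10 pa] // h.
by have := IH _ _ pa h; lia.
Qed.

Lemma gtn_trans : transitive gtn.
Proof. by move=> y x z /= yx zy; apply: ltn_trans zy yx. Qed.

(** Vertex 0 is joined to 1, ..., a0, and the rest is the graph of the tail shifted by one. Parts
    decrease strictly, so the edges of the tail stay among its first a0 vertices: vertex 0 dominates
    all non-isolated ones. *)
Lemma adj_sums a v : sorted gtn a -> all [pred i | 0 < i < v] a ->
  \sum_(x < v) \sum_(y < v) adj a x y = sumn a /\
  \sum_(x < v) adj_degree a v x ^ 2 = sqd a.
Proof.
elim: a v => [|a0 a IH] v.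
  have h x y : adj [::] x y = false by rewrite /adj nth_nil addn0; lia.
  move=> _ _; split; first by rewrite big1 // => x _; rewrite big1 // => y _; rewrite h.
  by rewrite big1 // => x _; rewrite /adj_degree big1 // => y _; rewrite !h.
case: v => [|v] /= pa /andP[/andP[a0_gt0 a0v] av]; first by lia.
have av' : all [pred i | 0 < i < v] a.
  have /allP h : all (gtn a0) a by apply: order_path_min pa; apply: gtn_trans.
  by apply/allP => i ia; move/allP: av => /(_ i ia) /=; have := h _ ia => /=; lia.
have [E1 E2] := IH v (path_sorted pa) av'.
have ord0E : nat_of_ord (ord0 : 'I_v.+1) = 0 by [].
have lift_nat (i : 'I_v) : nat_of_ord (lift ord0 i) = i.+1 by [].
have adj0 (y : nat) : adj (a0 :: a) 0 y.+1 = (y < a0) by rewrite /adj.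
have adjN0 (x : nat) b : adj b x 0 = false by [].
have s0 : \sum_(y < v) (y < a0) = a0 by apply: sum_ltn.
split.
  rewrite big_ord_recl big_ord_recl adjN0 add0n -[in RHS]s0 -E1; congr (_ + _).
  apply: eq_bigr => x _; rewrite big_ord_recl adjN0 add0n.
  by apply: eq_bigr => y _; rewrite !lift_nat adj_cons.
have d0 : adj_degree (a0 :: a) v.+1 0 = a0.
  rewrite /adj_degree big_ord_recl !adjN0 add0n -[RHS]s0.
  by apply: eq_bigr => y _; rewrite lift_nat ?ord0E adj0 adjN0 addn0.
have dS (x : 'I_v) : adj_degree (a0 :: a) v.+1 x.+1 = (x < a0) + adj_degree a v x.
  rewrite [in LHS]/adj_degree big_ord_recl ord0E adjN0 adj0; congr (_ + _).
have dx0 (x : 'I_v) : ~~ (x < a0) -> adj_degree a v x = 0.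
  move=> xa0; rewrite /adj_degree big1 // => y _.
  have h z t : adj a z t -> t < a0.
    rewrite /adj => zt; have := @path_gtn_nth a0 a z pa; lia.
  have := h x y; have := h y x; rewrite /adj; lia.
have sd : \sum_(x < v) adj_degree a v x = 2 * sumn a.
  transitivity (\sum_(x < v) (\sum_(y < v) adj a x y + \sum_(y < v) adj a y x)).
    by apply: eq_bigr => x _; rewrite -big_split.
  by rewrite big_split /= [X in _ + X]exchange_big /= E1; lia.
rewrite big_ord_recl ord0E d0.
transitivity (a0 ^ 2 + \sum_(x < v) (adj_degree a v x ^ 2 + 2 * adj_degree a v x + (x < a0))).
  congr (_ + _); apply: eq_bigr => x _; rewrite lift_nat dS.
  have := dx0 x; case: (x < a0) => [_|/(_ isT) ->] //; nia.
rewrite big_split big_split -big_distrr /= E2 sd s0; nia.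
Qed.

Lemma Th_simple v e a : a \in Dis v e ->
  Th v a \in simple_graphs v e /\ P2 (Th v a) = sqd a.
Proof.
case/and3P => sa aa /eqP ea; have [E1 E2] := adj_sums sa aa; split.
  rewrite inE card_Th E1 ea eqxx andbT; apply/forall_inP => E /imsetP[p].
  by rewrite inE => /andP[pl _] ->; rewrite cards2 -val_eqE /= neq_ltn pl.
by rewrite -E2; apply: eq_bigr => x _; rewrite degree_Th.
Qed.

Lemma parts_Dis b : parts b \in Dis (size b).+1 (sumn (parts b)).
Proof.
rewrite !inE eqxx andbT; elim: b => [//|x b /andP[sb ab]] /=.
have ab' : all [pred i | 0 < i < (size b).+2] (parts b).
  by apply: sub_all ab => i /=; lia.
case: x => /=; rewrite ab' ?ltnSn ?sb ?andbT //=.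
rewrite path_min_sorted //; apply: sub_all ab => i /=; lia.
Qed.

Lemma Dis_parts n e a : a \in Dis n.+1 e -> exists2 b, size b = n & parts b = a.
Proof.
case/and3P => sa aa _; elim: n a sa aa => [|n IH] a sa aa.
  by case: a sa aa => [|x a] /=; [exists [::] | lia].
have weaken c : sorted gtn c -> all [pred i | 0 < i < n.+1] c ->
    exists2 b, size b = n.+1 & parts b = c.
  by move=> sc /(IH _ sc) [b sb eb]; exists (false :: b); rewrite /= ?sb.
case: a sa aa => [|x a]; first by move=> *; apply: weaken.
move=> /= pa /andP[/andP[x0 xn] aa].
have ax : all (gtn x) a by apply: order_path_min pa; apply: gtn_trans.
case: (eqVneq x n.+1) => [ex|xn'].
  have [|b sb eb] := IH a (path_sorted pa).
    by apply/allP => i ia; move/allP: ax => /(_ i ia); move/allP: aa => /(_ i ia) /=; lia.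
  by exists (true :: b); rewrite /= sb // eb ex.
apply: weaken => //; apply/andP; split; first by rewrite /=; lia.
by apply/allP => i ia; move/allP: ax => /(_ i ia); move/allP: aa => /(_ i ia) /=; lia.
Qed.

(** * The Pell case *)

Lemma sumn_parts0 b : sumn (parts b) = 0 -> b = nseq (size b) false.
Proof. by elim: b => [//|[] b IH] //= /IH <-. Qed.

Lemma parts_all b : sumn (parts b) = 'C((size b).+1, 2) -> b = nseq (size b) true.
Proof.
rewrite -sumn_parts_negb -[LHS]addn0 => /eqP; rewrite eqn_add2l eq_sym => /eqP.
move/sumn_parts0; rewrite size_map => h.
by rewrite -[LHS](mapK negbK) h map_nseq.
Qed.

Lemma run_cons n m : m <= n.+1 -> run n.+1 m = n.+1 :: run n m.
Proof.
move=> mn; have rev1 x : rev (iota x 1) = [:: x] by [].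
rewrite /run (_ : n.+1 + 1 - m = (n + 1 - m) + 1); last by lia.
by rewrite iotaD rev_cat rev1; congr (_ :: _); lia.
Qed.

Lemma parts_nseq_true i b :
  parts (nseq i true ++ b) = run (i + size b) (size b).+1 ++ parts b.
Proof.
elim: i => [|i IH] /=; first by rewrite /run addn1 subnn.
by rewrite IH size_cat size_nseq addSn run_cons //; lia.
Qed.

Lemma parts_nseq_false n : parts (nseq n false) = [::].
Proof. by elim: n. Qed.

Lemma parts_single i n : parts (nseq i false ++ true :: nseq n false) = [:: n.+1].
Proof. by rewrite parts_ncons0 /= parts_nseq_false size_nseq. Qed.

Lemma sqd_le_star b : sqd (parts b) <= sumn (parts b) * (sumn (parts b)).+1.
Proof.
elim: b => [//|[] b IH] //=; have := sumn_parts_negb b; have := bin2D (size b).+1.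
by case: (size b) => [|m] /=; nia.
Qed.

(** A dominating vertex of degree M over t further edges loses at least 2 t (M - 2) against the
    star; the triangle is the tie excluded by [3 < _]. *)
Lemma star_unique b : 3 < sumn (parts b) ->
  sqd (parts b) = sumn (parts b) * (sumn (parts b)).+1 ->
  parts b = [:: sumn (parts b)].
Proof.
elim: b => [//|[] b IH] //= h.
have := sqd_le_star b; have := sumn_parts_negb b; have := bin2D (size b).+1.
case E: (sumn (parts b)) => [|s].
  by rewrite (sumn_parts0 E) size_nseq parts_nseq_false addn0.
rewrite E in h => B Q P F; exfalso; move: h B Q P F.
by case: (size b) => [|[|m]] h B Q P F; nia.
Qed.

Section Pell.

Variables v k : nat.
Hypothesis v6 : 5 < v.
(** The Pell equation, expanded and divided by 4. *)
Hypothesis pell : v.-1 * v.-2 = 2 * k * k.-1.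

Let e := 'C(k, 2).

(** The ratio v / k is close to the square root of 2. The solution v = 5, k = 3 would violate the
    bounds. *)
Lemma pell_bounds : [/\ 4 < k, k + 3 <= v & v + 3 <= 2 * k].
Proof.
move: pell; case: (v) v6 => [|[|w]] // h; case: k => [|m] /= E; first by lia.
have m3 : 2 < m by rewrite ltnNge; apply/negP => m2; have := leq_mul m2 m2; nia.
have m4 : 3 < m.
  rewrite ltnNge; apply/negP => m3'; have m_eq : m = 3 by lia.
  by move: E h; rewrite m_eq; case: w => [|[|[|[|[|[|w]]]]]] // E _; nia.
split; first by [].
  by rewrite leqNgt; apply/negP => wm; have := @leq_mul w m.+1 w.+1 m.+2; nia.
by rewrite leqNgt; apply/negP => wm; have := @leq_mul (2 * m - 2) w (2 * m - 1) w.+1; nia.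
Qed.

Lemma pell4 : 4 * e = v.-1 * v.-2.
Proof. by have := bin2D k; rewrite pell /e; lia. Qed.

Lemma pell_half : 'C(v.-1, 2) = 2 * e.
Proof. by have := bin2D v.-1; rewrite -pell4; lia. Qed.

Lemma pell_le : v.-1 <= e.
Proof.
have [k4 _ vk] := pell_bounds.
have := @bin2_lt k.-2 k.-1 ltac:(lia); have := @bin2_lt k.-1 k ltac:(lia).
by rewrite /e; lia.
Qed.

(** In [qc_row] with q = k - 2, the excess 2 r (u - 1) has r = 2 k - 3 - d >= 1 and u = d + 2 - k >=
    2. *)
Lemma qc_clique_gt d : k <= d -> d + 4 <= 2 * k ->
  qc (e - d) + 4 * (e - d) + d * d.+1 < qc e.
Proof.
have [k4 _ _] := pell_bounds; move=> kd dk.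
have q0 : k = (k - 2).+2 by lia.
have E : 'C(k - 2, 2) + (2 * k - 3 - d) + (k - 2 + (d + 2 - k)) = e.
  have -> : e = 'C((k - 2).+2, 2) by rewrite -q0.
  by rewrite !binS !bin1 bin0; lia.
have := @qc_row (k - 2) (2 * k - 3 - d) (d + 2 - k) ltac:(lia) ltac:(lia).
rewrite E; have -> : 'C(k - 2, 2) + (2 * k - 3 - d) = e - d by lia.
have -> : k - 2 + (d + 2 - k) = d by lia.
have : 2 * k - 3 - d > 0 by lia.
have : d + 2 - k > 1 by lia.
by move: (2 * k - 3 - d) (d + 2 - k) => r u; nia.
Qed.

(** On v - 2 vertices there are e - (v - 2) non-edges, and 4 e = (v - 1) (v - 2) turns the claim
    into [qc_clique_gt] at d = v - 2. *)
Lemma star_clique_lt :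
  qc ('C(v.-2, 2) - e) + 2 * v.-2.-1 * e < qc e + 2 * v.-2.-1 * ('C(v.-2, 2) - e).
Proof.
have [k4 kv vk] := pell_bounds.
have := @qc_clique_gt v.-2 ltac:(lia) ltac:(lia).
have := pell_half; have := pell4; have := pell_le.
have [d ed] : exists d, v = d.+3 by exists (v - 3); lia.
rewrite ed !succnK binS bin1 => h0 h1 h2.
have -> : 'C(d.+1, 2) - e = e - d.+1 by lia.
have [z ez] : exists z, e = z + d.+1 by exists (e - d.+1); lia.
by move: h1; rewrite ez addnK; lia.
Qed.

(** [qc_unique] with n0 = k - 1 leaves k vertices, which e edges fill completely. *)
Lemma clique_unique b : size b <= v.-2.-1 -> sumn (parts b) = e ->
  sqd (parts b) = qc e -> b = nseq (size b - k.-1) false ++ nseq k.-1 true.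
Proof.
have [k4 kv vk] := pell_bounds; move=> sb we Fe.
suff [b' eb sb'] : exists2 b', b = nseq (size b - k.-1) false ++ b' & size b' = k.-1.
  rewrite {1}eb; congr (_ ++ _); rewrite -sb'; apply: parts_all.
  by rewrite sb' prednK; [rewrite -/e -we eb parts_ncons0 | lia].
have [kb|bk] := leqP k (size b); last first.
  have : ~~ (size b < k.-1).
    apply/negP => h; have := @bin2_lt (size b).+1 k ltac:(lia).
    by have := sumn_parts_negb b; rewrite we /e; lia.
  by move=> h; exists b; [rewrite (_ : _ - _ = 0) //; lia | lia].
apply: (qc_unique we Fe) => [|d h|n h].
- by lia.
- by apply: qc_clique_gt; lia.
apply: (@star_lt _ _ v.-2); [lia | | exact: star_clique_lt].
have : 'C(k.+1, 2) <= 'C(n, 2) by apply: leq_bin2l; lia.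
by rewrite binS bin1 -/e; lia.
Qed.

(** In v vertices the complement has e + v - 1 edges, so this says that quasi-star and
    quasi-complete graph tie. *)
Lemma qc_costar : qc (e + v.-1) = qc e + 2 * v.-1 * v.-1.
Proof.
have [k4 kv vk] := pell_bounds.
have := @qc_row k 0 (v.-1 - k) isT ltac:(lia); rewrite !addn0 -/e.
have -> : k + (v.-1 - k) = v.-1 by lia.
by have := pell4; case: (v.-1) => [|d]; rewrite ?succnK; lia.
Qed.

Lemma qc_costar_gt d : k.+1 < d -> d < v.-1 ->
  qc (e + v.-1 - d) + 4 * (e + v.-1 - d) + d * d.+1 < qc (e + v.-1).
Proof.
have [k4 kv vk] := pell_bounds; move=> kd dv.
have := @qc_row k (v.-1 - d) (d - k) ltac:(lia) ltac:(lia).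
rewrite -/e -addnA; have -> : v.-1 - d + (k + (d - k)) = v.-1 by lia.
have -> : e + v.-1 - d = e + (v.-1 - d) by lia.
have -> : k + (d - k) = d by lia.
have : v.-1 - d > 0 by lia.
have : d - k > 1 by lia.
by move: (v.-1 - d) (d - k) => r u; nia.
Qed.

Lemma star_costar_lt (m := e + v.-1) :
  qc ('C(v.-1, 2) - m) + 2 * v.-2 * m < qc m + 2 * v.-2 * ('C(v.-1, 2) - m).
Proof.
have [k4 kv vk] := pell_bounds.
have := @qc_clique_gt v.-1 ltac:(lia) ltac:(lia).
have := qc_costar; rewrite -/m.
have h := pell_le.
have -> : 'C(v.-1, 2) - m = e - v.-1 by rewrite pell_half /m; lia.
have := pell4; rewrite {}/m.
have [z ez] : exists z, e = z + v.-1 by exists (e - v.-1); lia.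
rewrite {}ez addnK; case: (v.-1) => [|d]; first by lia.
by rewrite succnK; nia.
Qed.

(** The quasi-complete graph with e + v - 1 edges is K_(k+1) and a vertex joined to v - 1 - k
    others; its complement in k + 2 vertices is a star with j edges. *)
Lemma qc_costar_dual (j := 2 * k + 2 - v) :
  qc (e + v.-1) + 2 * k.+1 * j = j * j.+1 + 2 * k.+1 * (e + v.-1).
Proof.
have [k4 kv vk] := pell_bounds; rewrite {}/j.
have em : e + v.-1 = 'C(k.+1, 2) + (v.-1 - k) by rewrite binS bin1 -/e; lia.
have := @qcE k.+1 (v.-1 - k) ltac:(lia); rewrite -em.
have [r er] : exists r, v.-1 = k + r by exists (v.-1 - k); lia.
have [s es] : exists s, k.+1 = r + s by exists (k.+1 - r); lia.
have -> : v.-1 - k = r by lia.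
rewrite er; have -> : 2 * k + 2 - v = s by lia.
have h1 : s * (r + s) = s * k.+1 by rewrite es.
have h2 : r * (r + s) = r * k.+1 by rewrite es.
have h3 : k.+1 * (r + s) = k.+1 * k.+1 by rewrite es.
have : k.+1 * (2 * e) = k.+1 * (k * k.-1) by rewrite -bin2D.
by case: (k) h1 h2 h3 es k4 => // k'; rewrite succnK; lia.
Qed.

(** [qc_unique] leaves k + 2 vertices, where the complement has the P2 of a star and so is one by
    [star_unique]. *)
Lemma costar_unique b : size b = v.-2 -> sumn (parts b) = e + v.-1 ->
  sqd (parts b) = qc (e + v.-1) ->
  exists2 b', b = nseq (v - 3 - k) false ++ b' &
    parts (map negb b') = [:: 2 * k + 2 - v] /\ size b' = k.+1.
Proof.
have [k4 kv vk] := pell_bounds; move=> sb we Fe.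
suff [b' eb sb'] : exists2 b', b = nseq (v - 3 - k) false ++ b' & size b' = k.+1.
  exists b' => //; split=> //.
  have pb : parts b = parts b' by rewrite eb parts_ncons0.
  rewrite pb in we Fe.
  have := sumn_parts_negb b'; rewrite we sb' !binS !bin1 !bin0 -/e => E.
  have sj : sumn (parts (map negb b')) = 2 * k + 2 - v by lia.
  rewrite -sj; apply: star_unique; first by rewrite sj; lia.
  have := sqd_parts_negb b'; rewrite we Fe sb' sj.
  by have := qc_costar_dual; lia.
have [kb|bk] := leqP k.+2 (size b); last first.
  by exists b; [rewrite (_ : v - 3 - k = 0) //; lia | lia].
have -> : v - 3 - k = size b - k.+1 by lia.
apply: (qc_unique we Fe) => [|d h|n h].
- by lia.
- by apply: qc_costar_gt; lia.
apply: (@star_lt _ _ v.-1); [lia | | exact: star_costar_lt].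
have : 'C(k.+3, 2) <= 'C(n, 2) by apply: leq_bin2l; lia.
by rewrite !binS !bin1 !bin0 -/e; lia.
Qed.

Let three := [:: rcons (run (v - 1) (k + 2)) (2 * k + 2 - v); run (v - 2) k; run (k - 1) 1].

Lemma pell_bin : 'C(v, 2) = e + (e + v.-1).
Proof.
have -> : v = v.-1.+1 by lia.
by rewrite binS bin1 pell_half succnK -/e; lia.
Qed.

Lemma parts_negb_sum b : size b = v.-1 -> sumn (parts b) = e ->
  sumn (parts (map negb b)) = e + v.-1.
Proof.
move=> sb we; have := sumn_parts_negb b.
by rewrite sb we prednK ?pell_bin //; lia.
Qed.

(** By [qc_costar] the two alternatives of [sqd_parts_le] are the same bound. *)
Lemma pell_sqd_le b : size b = v.-1 -> sumn (parts b) = e ->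
  sqd (parts b) <= qc e.
Proof.
move=> sb we; have := sqd_parts_le b; rewrite (parts_negb_sum sb we) we sb.
by case=> //; have := qc_costar; rewrite -/e; move: (v.-1) => d; lia.
Qed.

Lemma pell_maximizers b : size b = v.-1 -> sumn (parts b) = e ->
  sqd (parts b) = qc e -> parts b \in three.
Proof.
have [k4 kv vk] := pell_bounds; move=> sb we Fe.
have wn := parts_negb_sum sb we; have := sqd_parts_negb b.
rewrite wn we Fe sb; have := qc_costar; rewrite -/e.
case: b sb we Fe wn => [|[] b] /= sb we Fe wn; first by lia.
  (* With a dominating vertex first, the complement starts with an isolated one. *)
  move=> Q Fn; have {}Fn : sqd (parts (map negb b)) = qc (e + v.-1).
    by rewrite Q; move: Fn; move: (v.-1) => d; lia.
  have sn : size (map negb b) = v.-2 by rewrite size_map; lia.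
  have [c eb [pc sc]] := costar_unique sn wn Fn.
  have {}eb : true :: b = nseq (v - 2 - k) true ++ map negb c.
    rewrite -[b](mapK negbK) eb map_cat map_nseq.
    by have -> : v - 2 - k = (v - 3 - k).+1 by lia.
  rewrite -[_ :: parts b]/(parts (true :: b)) eb parts_nseq_true pc size_map sc.
  rewrite !inE cats1; apply/orP; left; apply/eqP; congr (rcons (run _ _) _); lia.
move=> _ _.
case: b sb we Fe wn => [|[] b] /= sb we Fe wn; first by lia.
  have sn : size (map negb b) = v.-2.-1 by rewrite size_map; lia.
  (* On v - 1 vertices e edges are half of all, so the complement has equally many edges and the
     same P2. *)
  have wn' : sumn (parts (map negb b)) = e by rewrite size_map in wn; lia.
  have Fn : sqd (parts (map negb b)) = qc e.
    have := sqd_parts_negb (true :: b); rewrite /= Fe we wn'.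
    lia.
  have := clique_unique _ wn' Fn; rewrite sn => /(_ (leqnn _)) eb.
  have {}eb : true :: b = nseq (v - 1 - k) true ++ nseq k.-1 false.
    rewrite -[b](mapK negbK) eb map_cat !map_nseq.
    by have -> : v - 1 - k = (v.-2.-1 - k.-1).+1 by lia.
  rewrite -[_ :: parts b]/(parts (true :: b)) eb parts_nseq_true.
  rewrite parts_nseq_false cats0 size_nseq !inE; apply/orP; right; apply/orP; left.
  by apply/eqP; congr (run _ _); lia.
have := clique_unique _ we Fe => /(_ ltac:(lia)) ->.
rewrite parts_ncons0 -[nseq k.-1 _]cats0 parts_nseq_true cats0 !inE.
by apply/orP; right; apply/orP; right; apply/eqP; congr (run _ _); rewrite /=; lia.
Qed.

Lemma pell_attained a : a \in three ->
  exists2 b, size b = v.-1 & [/\ parts b = a, sumn a = e & sqd a = qc e].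
Proof.
have [k4 kv vk] := pell_bounds.
pose b3 := nseq (v - k) false ++ nseq k.-1 true.
have p3 : parts b3 = run (k - 1) 1.
  by rewrite parts_ncons0 -[nseq k.-1 _]cats0 parts_nseq_true cats0; congr (run _ _); rewrite /=; lia.
have w3 : sumn (run (k - 1) 1) = e /\ sqd (run (k - 1) 1) = qc e.
  rewrite -p3 parts_ncons0.
  have := sumn_parts_negb (nseq k.-1 true); have := sqd_parts_negb (nseq k.-1 true).
  rewrite map_nseq size_nseq parts_nseq_false /= addn0 prednK; last by lia.
  move=> F W; rewrite W in F *; split=> //; move: F.
  have := @qcE k 0 isT; have := bin2D k; rewrite -/e !addn0 !muln0 !addn0.
  have [k' ek] : exists k', k = k'.+1 by exists k.-1; lia.
  rewrite ek !succnK => B; have : k' * (2 * e) = k' * (k'.+1 * k') by rewrite B.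
  lia.
rewrite !inE => /or3P[] /eqP->.
(* [c] is the star of [qc_costar_dual] on k + 2 vertices. *)
- pose c := nseq (v - 1 - k) false ++ true :: nseq (2 * k + 1 - v) false.
  have sc : size c = k.+1 by rewrite /c size_cat /= !size_nseq; lia.
  have pc : parts c = [:: 2 * k + 2 - v] by rewrite /c parts_single; congr (_ :: _); lia.
  pose b := nseq (v - 2 - k) true ++ c.
  have sb : size b = v.-1 by rewrite /b size_cat sc size_nseq; lia.
  have pb : parts b = rcons (run (v - 1) (k + 2)) (2 * k + 2 - v).
    by rewrite /b parts_nseq_true sc pc cats1; congr (rcons (run _ _) _); lia.
  have pn : parts (map negb b) = parts (map negb c).
    by rewrite /b map_cat map_nseq parts_ncons0.
  have wc : sumn (parts (map negb c)) = e + v.-1.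
    have := sumn_parts_negb c; rewrite sc pc !binS !bin1 bin0 -/e /=; lia.
  have Fc : sqd (parts (map negb c)) = qc (e + v.-1).
    have := sqd_parts_negb c; rewrite wc sc pc /= ?addn0 ?muln0 ?add0n.
    by have := qc_costar_dual; rewrite -/e; lia.
  have wb : sumn (parts b) = e.
    have := sumn_parts_negb b; rewrite pn wc sb prednK ?pell_bin //; lia.
  exists b; rewrite // -pb; split=> //.
  have := sqd_parts_negb b; rewrite pn wc wb Fc sb qc_costar -/e.
  by move: (v.-1) => d; lia.
(* An isolated vertex and the complement of K_k in v - 1 vertices. *)
- pose c := nseq (v - 2 - k) false ++ nseq k.-1 true.
  have pc : parts c = run (k - 1) 1 by rewrite -p3 !parts_ncons0.
  have sc : size c = v.-2.-1 by rewrite size_cat !size_nseq; lia.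
  pose b := map negb c.
  have pt : parts (true :: b) = run (v - 2) k.
    have -> : true :: b = nseq (v - 1 - k) true ++ nseq k.-1 false.
      by rewrite /b map_cat !map_nseq (_ : v - 1 - k = (v - 2 - k).+1) //; lia.
    by rewrite parts_nseq_true parts_nseq_false cats0 size_nseq; congr (run _ _); lia.
  have st : size (true :: b) = v.-2 by rewrite /= size_map sc; lia.
  have pn : parts (map negb (true :: b)) = run (k - 1) 1 by rewrite /= (mapK negbK).
  have := sumn_parts_negb (true :: b); have := sqd_parts_negb (true :: b).
  rewrite pn pt st w3.1 w3.2 => F W.
  have {}W : sumn (run (v - 2) k) = e.
    by move: W; rewrite prednK ?pell_half -/e; lia.
  exists [:: false, true & b]; first by rewrite -[size _]/(size (true :: b)).+1 st; lia.
  by split=> //; move: F; rewrite W; lia.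
- exists b3; first by rewrite size_cat !size_nseq; lia.
  by rewrite p3; case: w3.
Qed.

End Pell.

(** * ** The two representations of e and the optimal partitions *)

Lemma rem_run n m : m <= n.+1 -> rem n.+1 (run n.+1 m) = run n m.
Proof. by move=> mn; rewrite run_cons //= eqxx. Qed.

Lemma complete_rep_clique k : 0 < k ->
  unique (fun r => complete_rep 'C(k, 2) r.1 r.2) (k, k).
Proof.
move=> k0; split=> [|[q j] [/= E jq]].
  by split; rewrite /= ?binS ?bin1; lia.
have {}E : 'C(k, 2) + j = 'C(q, 2) + q by move: E; rewrite binS bin1; lia.
have [/bin2_lt|/bin2_lt|qk] := ltngtP q k; [lia | lia |].
by rewrite qk in E *; congr pair; lia.
Qed.

Lemma star_rep_unique v e k j : star_rep v e k j ->
  unique (fun r => star_rep v e r.1 r.2) (k, j).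
Proof.
move=> [E jk]; split=> [//|[k' j'] [/= E' jk']].
move: E E'; rewrite !binS !bin1 => E E'.
have {E E'} E : 'C(k, 2) + k + j' = 'C(k', 2) + k' + j by lia.
have [/bin2_lt|/bin2_lt|kk] := ltngtP k k'; [lia | lia |].
by rewrite kk in E *; congr pair; lia.
Qed.

Lemma P2_clique_max v k (G : {set {set 'I_v}}) :
  5 < v -> v.-1 * v.-2 = 2 * k * k.-1 -> G \in simple_graphs v 'C(k, 2) ->
  P2 G <= qc 'C(k, 2).
Proof.
move=> v6 pell; rewrite inE => /andP[/forall_inP G2 /eqP cG].
have GT : graph_on [set: 'I_v] G by apply/forall_inP => E /G2 ->; rewrite subsetT.
have [|b sb [wb Fb]] := P2_le_sqd (n := v.-1) GT; first by rewrite cardsT card_ord; lia.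
by apply: leq_trans Fb (pell_sqd_le v6 pell sb _); rewrite wb.
Qed.

Theorem theorem4 (v k e : nat) (hv : 5 < v) (hk : 0 < k)
    (pell : ((2 * v%:Z - 3) ^+ 2 - 2 * (2 * k%:Z - 1) ^+ 2 = -1)%R)
    (he : e = 'C(k, 2)) :
  exists ke j k' j' : nat,
    unique (fun r => complete_rep e r.1 r.2) (ke, j) /\
    unique (fun r => star_rep v e r.1 r.2) (k', j') /\
    [/\ ke = k, j = k, k' = k + 1 & (j'%:Z = 2 * k%:Z - v%:Z + 2)%R] /\
    exists p11 p12 p21 : seq nat,
      [/\ pi11 v k' j' = p11, pi12 v k' j' = Some p12 & pi21 ke j = p21] /\
      [/\ p11 = rcons (run (v - 1) (k + 2)) (2 * k + 2 - v),
          p12 = run (v - 2) k & p21 = run (k - 1) 1] /\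
      uniq [:: p11; p12; p21] /\
      (forall a : seq nat, optimal v e a <-> a \in [:: p11; p12; p21]) /\
      [/\ pi13 v k' j' = None, pi22 v ke j = None & pi23 v ke j = None].
Proof.
subst e.
have pell' : v.-1 * v.-2 = 2 * k * k.-1.
  case: v hv pell => [|[|v]] //; case: k hk => // k _ _; rewrite !succnK !GRing.expr2; lia.
have [k4 kv vk] := pell_bounds hv pell'.
exists k, k, (k + 1), (2 * k + 2 - v).
split; first exact: complete_rep_clique.
split.
  apply: star_rep_unique; split; last by lia.
  by rewrite (pell_bin hv pell') !addn1 !binS !bin1 bin0; lia.
split; first by split=> //; lia.
exists (rcons (run (v - 1) (k + 2)) (2 * k + 2 - v)), (run (v - 2) k), (run (k - 1) 1).
have [w ew] : exists w, v = w.+3 by exists (v - 3); lia.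
have [m em] : exists m, k = m.+1 by exists k.-1; lia.
split; first split.
- by rewrite /pi11 -addnA.
(* The omitted entry is the largest one, here and in [pi21]. *)
- rewrite /pi12; have -> : 2 * (k + 1) - (2 * k + 2 - v) - 1 = v - 1 by lia.
  rewrite leqnn andbT addnK ifT; last by lia.
  by rewrite ew !subSS !subn0 rem_run //; lia.
- by rewrite /pi21 em rem_run // subSS subn0.
split; first by split.
split.
  have -> : run (v - 1) (k + 2) = v.-1 :: run v.-2 (k + 2).
    by rewrite ew subSS subn0 run_cons //; lia.
  have -> : run (v - 2) k = v.-2 :: run (v - 3) k.
    by rewrite ew !subSS !subn0 run_cons //; lia.
  have -> : run (k - 1) 1 = k.-1 :: run (k - 2) 1.
    have -> : k = (k - 2).+2 by lia.
    by rewrite !subSS !subn0 run_cons.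
  by rewrite rcons_cons /= !inE !eqseq_cons; lia.
split; last first.
  (* Here j' >= 5, 2 ke - j - 1 = k - 1 < ke + 1, and j = k > 4. *)
  by rewrite /pi13 /pi22 /pi23; split; rewrite ifF //; lia.
move=> a; split=> [[aD amax]|/(pell_attained hv pell') [b sb [pb wa Fa]]].
  have [_ PTa] := Th_simple aD.
  have [b sb pb] : exists2 b, size b = v.-1 & parts b = a.
    by apply: (@Dis_parts v.-1 'C(k, 2)); rewrite prednK //; lia.
  have wa : sumn a = 'C(k, 2) by case/and3P: aD => _ _ /eqP.
  rewrite -pb; apply: (pell_maximizers hv pell') => //; rewrite pb //.
  apply/eqP; rewrite eqn_leq -{1}pb (pell_sqd_le hv pell' sb) ?pb // -PTa.
  (* An optimal partition is compared with the clique, which attains the bound. *)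
  have [|c sc [pc wc Fc]] := @pell_attained v k hv pell' (run (k - 1) 1).
    by rewrite !inE eqxx !orbT.
  have cD : run (k - 1) 1 \in Dis v 'C(k, 2).
    by rewrite -wc -pc (_ : v = (size c).+1) ?parts_Dis // sc prednK //; lia.
  by have [cS Pc] := Th_simple cD; rewrite -Fc -Pc; apply: amax.
have aD : a \in Dis v 'C(k, 2).
  by rewrite -wa -pb (_ : v = (size b).+1) ?parts_Dis // sb prednK //; lia.
split=> // G GS; have [_ ->] := Th_simple aD.
by rewrite Fa; apply: P2_clique_max.
Qed.
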